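(* Let $\varphi:\mathbb{R}\to\mathbb{R}$ be measurable, and suppose there exist $\delta>0$ and $\widetilde{\varphi}:\mathbb{R}\to\mathbb{R}$ such that (1) $\widetilde{\varphi}\equiv\varphi$ on $U_\delta=[1-\delta,1+\delta]$; (2) $\widetilde{\varphi}\in C^3(\mathbb{R})$ and $|\widetilde{\varphi}'''(x)|\le M$ for some constant $M$ and all $x\in\mathbb{R}$; (3) $\int_{\mathbb{R}}|\varphi-\widetilde{\varphi}|\,dx<\infty$. Let $(\Omega,\mathcal{F}_0,\mathbb{P})$ be a probability space, $\mathcal{F}\subseteq\mathcal{F}_0$ a sub-$\sigma$-algebra, $f$ and $g$ bounded $\mathcal{F}$-measurable random variables, and $\xi$ a random variable independent of $\mathcal{F}$ with $\mathbf{E}\xi=0$, $\mathbf{E}\xi^2=1$, $\mathbf{E}|\xi|^3<\infty$, possessing a probability density $p$ with $x^3p(x)\to0$ as $|x|\to\infty$. Let $h>0$. Then, almost surely, $$\mathbf{E}\Big[\varphi\big(1+fh+g\sqrt{h}\,\xi\big)\,\Big|\,\mathcal{F}\Big]=\varphi(1)+\varphi'(1)fh+\frac{\varphi''(1)}{2}g^2h+hf\,\varepsilon_1+hg^2\,\varepsilon_2,$$ where the error terms $\varepsilon_1,\varepsilon_2$ (depending on $h,f,g$) satisfy: (i) for every $K>0$, on $\{|f|<K,\ |g|<K\}$ we have $\varepsilon_1,\varepsilon_2\to0$ as $h\to0$, uniformly in $f$ and $g$; (ii) for every $H>0$, for $h<H$ we have $\varepsilon_1,\varepsilon_2\to0$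 as $f\to0$ and $g\to0$, uniformly in $h$.
   Context: Since $\varphi=\widetilde{\varphi}$ on a neighbourhood of $1$, the derivatives $\varphi'(1),\varphi''(1)$ exist and equal those of $\widetilde{\varphi}$. The error terms are written in the paper as $o(1)$.
   Formalization: The expansion is stated for those f, g, h for which φ(1+fh+g√hξ) is integrable, so that its conditional expectation exists; this does not follow from the hypotheses for every h>0 (φ−φ̃ and p may both have integrable singularities). *)

(* Defs.v *)
From HB Require Import structures.
From mathcomp Require Import all_boot all_order all_algebra.
From mathcomp Require Import all_classical all_reals all_analysis.
Set Implicit Arguments. Unset Strict Implicit. Unset Printing Implicit Defensive.
Import Order.TTheory GRing.Theory Num.Theory.
Import numFieldNormedType.Exports.
Local Open Scope classical_set_scope.
Local Open Scope ring_scope.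

Section Defs.
Context {d : measure_display} {Omega : measurableType d} {R : realType}.

Definition is_sub_sigma_algebra (G : set (set Omega)) :=
  sigma_algebra setT G /\ G `<=` measurable.

Definition measurable_wrt (G : set (set Omega)) (f : Omega -> R) :=
  forall B : set R, measurable B -> G (f @^-1` B).

Definition indep_sigma (P : probability Omega R) (G : set (set Omega))
  (xi : Omega -> R) :=
  forall A B, G A -> measurable B ->
    P (A `&` xi @^-1` B) = (P A * P (xi @^-1` B))%E.

Definition is_cond_exp (P : probability Omega R) (G : set (set Omega))
  (X Y : Omega -> R) :=
  [/\ P.-integrable setT (EFin \o X),
      measurable_wrt G Y,
      P.-integrable setT (EFin \o Y) &
      forall A, G A ->
        (\int[P]_(w in A) (Y w)%:E = \int[P]_(w in A) (X w)%:E)%E].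

Definition is_density (P : probability Omega R) (xi : Omega -> R)
  (p : R -> R) :=
  [/\ measurable_fun setT p,
      (forall x, 0 <= p x) &
      forall B : set R, measurable B ->
        P (xi @^-1` B) = (\int[lebesgue_measure]_(x in B) (p x)%:E)%E].

End Defs.

(* Main.v *)
Require Import Defs.
From HB Require Import structures.
From mathcomp Require Import all_boot all_order all_algebra.
From mathcomp Require Import all_classical all_reals all_analysis.
From mathcomp Require Import measurable_realfun ring lra.
Import Order.TTheory GRing.Theory Num.Theory.
Import numFieldNormedType.Exports.
Local Open Scope classical_set_scope.
Local Open Scope ring_scope.

(* The expectation depends on (h, a, b) only through s = a h and t = b sqrt h.
   Writing mu for the law of xi and G s t for the integral of phi (1 + s + t x)
   against mu, put eps1 = (phi (1 + s) - phi 1 - phi' 1 s) / s and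
   eps2 = (G s t - phi (1 + s) - phi'' 1 / 2 t^2) / t^2.  Differentiability makes
   eps1 small with s.  For eps2, expand phit at 1 + s to second order: the linear
   term vanishes since xi is centred, the cubic remainder is O(|t|^3), and
   phi'' (1 + s) is close to phi'' 1.  The discrepancy phi - phit only sees
   |x| >= delta / (2 |t|), where p x = o(|t|^3); after the affine change of
   variables its contribution is o(t^2) times the L1 norm of phi - phit. *)

(** * Taylor estimates with uniform constants *)

Section taylor.
Context {R : realType}.
Implicit Types (f : R -> R) (c v K M : R).

(** The mean value theorem between [c] and [c + v], for either sign of [v]. The derivative is
    controlled only within distance [|v|] of [c], so [K] may depend on [v]. *)
Lemma norm_increment_le f c v K : (forall x, derivable f x 1) ->
  (forall y, `|y - c| <= `|v| -> `|derive1 f y| <= K) ->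
  `|f (c + v) - f c| <= K * `|v|.
Proof.
move=> df bf.
have fd (x : R) : is_derive x 1 f (derive1 f x).
  by rewrite derive1E; exact: derivableP.
have cf : continuous f by move=> x; apply/differentiable_continuous/derivable1_diffP.
have [v0|v0] := leP 0 v.
  have := @MVT_segment R f (derive1 f) c (c + v).
  rewrite lerDl => /(_ v0 (fun x _ => fd x) (continuous_subspaceT cf)).
  move=> [y]; rewrite in_itv/= => /andP[y1 y2] ->.
  rewrite addrAC subrr add0r normrM ler_wpM2r// bf//.
  by rewrite !ger0_norm// ?subr_ge0//; lra.
have := @MVT_segment R f (derive1 f) (c + v) c.
rewrite gerDl (ltW v0) => /(_ isT (fun x _ => fd x) (continuous_subspaceT cf)).
move=> [y]; rewrite in_itv/= => /andP[y1 y2]; rewrite distrC => ->.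
rewrite opprD addrA subrr add0r normrM normrN ler_wpM2r// bf//.
by rewrite ler0_norm ?(ltr0_norm v0)// ?subr_le0//; lra.
Qed.

(** Three uses of the mean value inequality, from the second derivative down to [f], each gaining a
    factor [|v|]. This gives the constant [M] instead of the sharp [M / 6]. *)
Lemma taylor2_norm_le f c v M :
  (forall x, derivable f x 1) ->
  (forall x, derivable (derive1 f) x 1) ->
  (forall x, derivable (derive1n 2 f) x 1) ->
  (forall x, `|derive1n 3 f x| <= M) ->
  `|f (c + v) - (f c + derive1 f c * v + derive1n 2 f c / 2 * v ^+ 2)| <=
  M * `|v| ^+ 3.
Proof.
move=> df ddf d3f Mf.
have d2le y : `|derive1n 2 f y - derive1n 2 f c| <= M * `|y - c|.
  have := @norm_increment_le (derive1n 2 f) c (y - c) M d3f.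
  by rewrite subrKC; apply => z _; exact: Mf.
have M0 : 0 <= M by apply: le_trans (Mf 0).
have d1le y : `|derive1 f y - (derive1 f c + derive1n 2 f c * (y - c))| <=
    M * `|y - c| ^+ 2.
  (* Subtracting the linear term leaves a derivative that [d2le] bounds by [M * |y - c|] within
     distance [|y - c|] of [c]. *)
  pose g := fun z => derive1 f z - derive1n 2 f c * (z - c).
  have gd (x : R) : is_derive x 1 g (derive1n 2 f x - derive1n 2 f c).
    have fd : is_derive x 1 (derive1 f) (derive1n 2 f x).
      by rewrite /= derive1E; exact: derivableP.
    rewrite /g; apply: is_derive_eq; rewrite /GRing.scale/=.
    by rewrite subr0 mulr1.
  have gE x : derive1 g x = derive1n 2 f x - derive1n 2 f c.
    by rewrite derive1E; exact: derive_val.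
  have := @norm_increment_le g c (y - c) (M * `|y - c|).
  rewrite subrKC => /(_ (fun x => @ex_derive _ _ _ _ _ _ _ (gd x))).
  rewrite expr2 mulrA /g subrr mulr0 subr0 => H.
  rewrite [X in `|X|](_ : _ =
    derive1 f y - derive1n 2 f c * (y - c) - derive1 f c); last by ring.
  apply: H => z zc; rewrite gE (le_trans (d2le z))// ler_wpM2l//.
pose g := fun z => f z - derive1 f c * (z - c) - derive1n 2 f c / 2 * (z - c) ^+ 2.
have gd (x : R) :
    is_derive x 1 g (derive1 f x - derive1 f c - derive1n 2 f c * (x - c)).
  have fd : is_derive x 1 f (derive1 f x).
    by rewrite /= derive1E; exact: derivableP.
  rewrite /g; apply: is_derive_eq; rewrite /GRing.scale/=.
  by move: (derive1 f x) (derive1 f c) (derive1 (derive1 f) c) => u w ?; field.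
have gE x : derive1 g x = derive1 f x - derive1 f c - derive1n 2 f c * (x - c).
  by rewrite derive1E; exact: derive_val.
have := @norm_increment_le g c v (M * `|v| ^+ 2)
  (fun x => @ex_derive _ _ _ _ _ _ _ (gd x)).
rewrite /g [c + v - c]addrC addKr subrr expr0n/= !mulr0 !subr0 => H.
rewrite [`|v| ^+ 3]exprSr [X in _ <= X]mulrA.
have -> : f (c + v) - (f c + derive1 f c * v + derive1n 2 f c / 2 * v ^+ 2) =
    f (c + v) - derive1 f c * v - derive1n 2 f c / 2 * v ^+ 2 - f c.
  by move: (derive1n 2 f c / 2) (f (c + v)) => u w; ring.
apply: H => z zc; rewrite gE -addrA -opprD (le_trans (d1le z))// ler_wpM2l//.
by rewrite lerXn2r// nnegrE.
Qed.

End taylor.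

(** * Affine change of variables for Lebesgue measure *)

Definition pushforward_measure d d' (T : measurableType d) (T' : measurableType d')
    (R : realType) (m : {measure set T -> \bar R}) (f : T -> T')
    (mf : measurable_fun setT f) : {measure set T' -> \bar R} :=
  measure_function_pushforward__canonical__measure_function_Measure m mf.
Arguments pushforward_measure {d d' T T' R} m {f} mf.

Section lebesgue_affine.
Context {R : realType}.
Local Notation lambda := (@lebesgue_measure R).

Let aff (c t : R) : measurableTypeR R -> measurableTypeR R := fun x => c + t * x.

Lemma measurable_affine (c t : R) : measurable_fun setT (fun x : R => c + t * x).
Proof. by apply: measurable_funD => //; exact: measurable_funM. Qed.

(** Lebesgue measure is determined by its values on half-open intervals, so it suffices to compare
    it there with [|t|] times its own pushforward. *)
Lemma lebesgue_measure_affine (c t : R) (B : set R) : t != 0 -> measurable B ->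
  lambda ((fun x => c + t * x) @^-1` B) = (`|t|^-1%:E * lambda B)%E.
Proof.
move=> t0 mB.
have nt0 : 0 < `|t| by rewrite normr_gt0.
have maff : measurable_fun setT (aff c t) by exact: measurable_affine.
pose m := mscale (NngNum (ltW nt0)) (pushforward_measure lambda maff).
suff -> : lambda B = m B.
  by rewrite /m /mscale /= muleA -EFinM mulVf ?mul1e// gt_eqF.
apply: lebesgue_measure_unique => // _ [[a b]] _ <-.
rewrite [RHS](_ : _ = (`|t|%:E * lambda (aff c t @^-1` `]a, b]))%E)//.
have [tp|tn|t00] := ltgtP 0 t; last by rewrite -t00 eqxx in t0.
- rewrite (_ : aff c t @^-1` _ = `](a - c) / t, (b - c) / t]%classic); last first.
    apply/seteqP; split => x /=; rewrite !in_itv/= /aff ltr_pdivrMr// ler_pdivlMr//.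
      by move=> /andP[? ?]; apply/andP; split; lra.
    by move=> /andP[? ?]; apply/andP; split; lra.
  rewrite !lebesgue_measure_itv/= !lte_fin ltr_pM2r ?invr_gt0// ltrD2r.
  case: ifP => _; last by rewrite mule0.
  by rewrite -!EFinD -EFinM gtr0_norm//; congr EFin; field.
(* A negative slope reverses the interval, so its preimage is closed on the left; the length is
   unaffected. *)
- rewrite (_ : aff c t @^-1` _ = `[(b - c) / t, (a - c) / t[%classic); last first.
    apply/seteqP; split => x /=; rewrite !in_itv/= /aff ler_ndivrMr// ltr_ndivlMr//.
      by move=> /andP[? ?]; apply/andP; split; lra.
    by move=> /andP[? ?]; apply/andP; split; lra.
  rewrite !lebesgue_measure_itv/= !lte_fin ltr_nM2r ?invr_lt0// ltrD2r.
  case: ifP => _; last by rewrite mule0.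
  by rewrite -!EFinD -EFinM ltr0_norm//; congr EFin; field.
Qed.

Lemma ge0_integral_affine (c t : R) (k : R -> R) : t != 0 ->
  measurable_fun setT k -> (forall x, 0 <= k x) ->
  (\int[lambda]_x (k (c + t * x))%:E = `|t|^-1%:E * \int[lambda]_x (k x)%:E)%E.
Proof.
move=> t0 mk k0.
have maff : measurable_fun setT (aff c t) by exact: measurable_affine.
have nt0 : 0 <= `|t|^-1 by rewrite invr_ge0.
have := @ge0_integral_pushforward _ _ _ _ R (aff c t) maff lambda setT
  (EFin \o k) measurableT.
rewrite preimage_setT => <-; last 2 first.
- by apply/measurable_EFinP.
- by move=> y _ /=; rewrite lee_fin.
rewrite -(@ge0_integral_mscale _ _ _ lambda setT measurableT (NngNum nt0));
  last 2 first.
- by apply/measurable_EFinP.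
- by move=> y _; rewrite lee_fin.
apply: (@eq_measure_integral _ _ _ setT (mscale (NngNum nt0) lambda)
  (pushforward_measure lambda maff)) => A mA _.
exact: lebesgue_measure_affine.
Qed.

End lebesgue_affine.

(** * Domination of a measure through a bound on its density *)

Section bounded_density.
Context {R : realType}.
Local Notation lambda := (@lebesgue_measure R).

(** On [S] the measure [mu] is at most [w] times Lebesgue measure. The right side runs over the
    whole line so that an affine change of variables applies to it directly. *)
Lemma ge0_integral_bounded_density (mu : {measure set (measurableTypeR R) -> \bar R})
    (p : R -> R) (S : set R) (w : R) (k : R -> R) :
  measurable_fun setT p -> (forall x, 0 <= p x) ->
  (forall B : set R, measurable B -> mu B = (\int[lambda]_(x in B) (p x)%:E)%E) ->
  measurable S -> 0 <= w -> (forall x, S x -> p x <= w) ->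
  measurable_fun setT k -> (forall x, 0 <= k x) ->
  (\int[mu]_(x in S) (k x)%:E <= w%:E * \int[lambda]_x (k x)%:E)%E.
Proof.
move=> mp p0 muE mS w0 pw mk k0.
have mk' : measurable_fun setT (EFin \o k) by exact/measurable_EFinP.
(* Once [mu] is restricted to [S], the domination holds on every measurable set, as the comparison
   of integrals demands. *)
rewrite (eq_measure_integral (mrestr mu mS)); last first.
  by move=> A mA AS; rewrite /= /mrestr (setIidl AS).
apply: (@le_trans _ _ (\int[mscale (NngNum w0) lambda]_(x in S) (k x)%:E)%E).
  apply: ge0_le_measure_integral => //.
    move=> B mB; rewrite /= /mrestr /mscale/= muE; last exact: measurableI.
    apply: (@le_trans _ _ (\int[lambda]_(x in B `&` S) w%:E)%E).
      apply: ge0_le_integral => //; first exact: measurableI.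
      - by move=> x _; rewrite lee_fin.
      - by apply/measurable_EFinP/measurable_funTS.
      - by move=> x [_ Sx]; rewrite lee_fin pw.
    rewrite integral_cst//; last exact: measurableI.
    by rewrite lee_wpmul2l ?lee_fin// le_measure// inE//; exact: measurableI.
rewrite ge0_integral_mscale//; last 2 first.
- exact: measurable_funTS.
- by move=> x _; rewrite lee_fin.
rewrite lee_wpmul2l ?lee_fin//.
by apply: ge0_subset_integral => // x _; rewrite lee_fin.
Qed.

End bounded_density.

(** * Contribution of the discrepancy away from 1 *)

Section density_tail.
Context {R : realType}.
Local Notation lambda := (@lebesgue_measure R).

Lemma cvg_pinfty_ninfty_norm_le (q : R -> R) (e : R) : 0 < e ->
  q @ +oo --> 0 -> q @ -oo --> 0 ->
  exists2 A, 0 < A & forall x, A <= `|x| -> `|q x| <= e.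
Proof.
move=> e0 /cvgr0Pnorm_le /(_ _ e0)[A1 [_ HA1]] /cvgr0Pnorm_le /(_ _ e0)[A2 [_ HA2]].
(* The sum dominates both thresholds; the 1 makes it positive and the comparisons strict. *)
exists (1 + `|A1| + `|A2|); first by rewrite -addrA ltr_pwDl// addr_ge0.
move=> x; have := ler_norm A1; have := ler_norm (- A2); rewrite normrN.
have := normr_ge0 A1; have := normr_ge0 A2 => a2 a1 b2 b1.
have [x0 hx|x0 hx] := ger0P x.
  by apply: HA1; lra.
by apply: HA2; lra.
Qed.

(** Here [psi] stands for [phi - phit]. The tail of [p] supplies [|t| ^+ 3] and the change of
    variables takes back one power, leaving [t ^+ 2] uniformly in [s]. *)
Lemma affine_tail_integral_small (mu : {measure set (measurableTypeR R) -> \bar R})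
    (p psi : R -> R) (delta : R) :
  measurable_fun setT p -> (forall x, 0 <= p x) ->
  (forall B : set R, measurable B -> mu B = (\int[lambda]_(x in B) (p x)%:E)%E) ->
  (fun x => x ^+ 3 * p x) @ +oo --> 0 ->
  (fun x => x ^+ 3 * p x) @ -oo --> 0 ->
  0 < delta -> (forall y, `|y - 1| <= delta -> psi y = 0) ->
  lambda.-integrable setT (EFin \o psi) ->
  forall e, 0 < e -> exists2 eta, 0 < eta & forall s t, `|s| < eta -> `|t| < eta ->
    t != 0 -> (\int[mu]_x `|psi (1 + s + t * x)|%:E <= (e * t ^+ 2)%:E)%E.
Proof.
move=> mp p0 muE py pNy d0 psi0 ipsi e e0.
have mpsi : measurable_fun setT psi by apply/measurable_EFinP; case/integrableP: ipsi.
have mk : measurable_fun setT (fun x => `|psi x|) by exact: measurableT_comp.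
set I := (\int[lambda]_x `|psi x|%:E)%E.
have If : I \is a fin_num.
  exact: (integrable_fin_num measurableT (integrable_abse ipsi)).
have I0 : 0 <= fine I by rewrite fine_ge0// integral_ge0.
(* Chosen so that [e' / r ^+ 3 / |t|] times [I] equals [e * t ^+ 2 * I / (I + 1)]; the 1 covers the
   case where [I] vanishes. *)
set e' := e * delta ^+ 3 / (8 * (fine I + 1)).
have I1 : 0 < fine I + 1 by rewrite ltr_wpDl.
have e'0 : 0 < e' by rewrite divr_gt0 ?mulr_gt0 ?exprn_gt0.
have [A A0 HA] := cvg_pinfty_ninfty_norm_le _ _ e'0 py pNy.
(* The first bound lets [s] use up at most half of [delta]; the second puts the radius [r] beyond
   [A], where the tail bound on [p] is available. *)
exists (Num.min (delta / 2) (delta / (2 * A))).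
  by rewrite lt_min !divr_gt0// mulr_gt0.
move=> s t; rewrite !lt_min => /andP[s1 _] /andP[_ t2] t0.
have nt0 : 0 < `|t| by rewrite normr_gt0.
set r := delta / (2 * `|t|).
have r0 : 0 < r by rewrite divr_gt0// mulr_gt0.
have Ar : A <= r.
  rewrite /r ler_pdivlMr ?mulr_gt0//.
  move: t2; rewrite ltr_pdivlMr ?mulr_gt0// => /ltW; congr (_ <= _); ring.
set w := e' / r ^+ 3.
have w0 : 0 <= w by rewrite divr_ge0 ?exprn_ge0// ltW.
pose S := [set x : R | r <= `|x|].
have mS : measurable S.
  have -> : S = (fun x : R => `|x|) @^-1` `[r, +oo[.
    by apply/seteqP; split => x; rewrite /S /= in_itv/= andbT.
  rewrite -[X in measurable X]setTI.
  exact: normr_measurable.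
have pw x : S x -> p x <= w.
  rewrite /S/= => rx; have := HA _ (le_trans Ar rx).
  rewrite normrM normrX (ger0_norm (p0 x)) => h.
  rewrite /w ler_pdivlMr ?exprn_gt0//.
  by apply: le_trans h; rewrite mulrC ler_wpM2r// lerXn2r// nnegrE// ltW.
have maff := @measurable_affine R (1 + s) t.
(* Off [S], [s] and [t * x] are each at most [delta / 2] in absolute value, so [psi] vanishes
   there. *)
rewrite (_ : (\int[mu]_x `|psi (1 + s + t * x)|%:E)%E =
    (\int[mu]_(x in S) `|psi (1 + s + t * x)|%:E)%E); last first.
  rewrite [RHS]integral_mkcond; apply: eq_integral => x _; rewrite patchE.
  case: ifPn => // /negP xS; rewrite psi0 ?normr0//.
  have xr : `|x| < r.
    by rewrite ltNge; apply/negP => rx; apply: xS; rewrite inE.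
  rewrite (_ : 1 + s + t * x - 1 = s + t * x); last by ring.
  apply: (le_trans (ler_normD _ _)).
  rewrite [leRHS](_ : _ = delta / 2 + delta / 2); last by field.
  apply: lerD; first exact: ltW.
  rewrite normrM mulrC -ler_pdivlMr// (le_trans (ltW xr))// /r invfM mulrA//.
apply: (le_trans (@ge0_integral_bounded_density R mu p S w
  (fun x => `|psi (1 + s + t * x)|) mp p0 muE mS w0 pw _ _)) => //.
  exact: (measurableT_comp mk).
rewrite (ge0_integral_affine (1 + s) t (fun x => `|psi x|))// -/I.
rewrite -(fineK If) -!EFinM lee_fin /w /r /e'.
rewrite -real_normK ?num_real//.
rewrite [leLHS](_ : _ = e * `|t| ^+ 2 * (fine I / (fine I + 1))); last first.
  by field; rewrite !gt_eqF.
rewrite ler_piMr ?mulr_ge0 ?exprn_ge0// ?ltW//.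
by rewrite ltr_pdivrMr// mul1r ltrDl.
Qed.

End density_tail.

(** * Second-order expansion of the expectation *)

Section quadratic_expansion.
Context {R : realType}.
Local Notation lambda := (@lebesgue_measure R).

(** Splitting at [|X| = 1] bounds both [|X|] and [X ^+ 2] by [1 + |X| ^+ 3], and constants are
    integrable for a probability. *)
Lemma integrable_third_moment (d : measure_display) (T : measurableType d)
    (P : probability T R) (X : T -> R) : measurable_fun setT X ->
  P.-integrable setT (EFin \o (fun w => `|X w| ^+ 3)) ->
  P.-integrable setT (EFin \o X) /\
  P.-integrable setT (EFin \o (fun w => X w ^+ 2)).
Proof.
move=> mX i3.
have i1 : P.-integrable setT (EFin \o (fun=> 1)).
  exact: finite_measure_integrable_cst.
have i13 : P.-integrable setT (EFin \o (fun w => 1 + `|X w| ^+ 3)).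
  exact: (integrableD measurableT i1 i3).
split.
- apply: le_integrable i13 => //; first exact/measurable_EFinP.
  move=> w _ /=; rewrite lee_fin; have := normr_ge0 (X w); move: `|X w| => y y0.
  rewrite ger0_norm; last by rewrite addr_ge0// exprn_ge0.
  have [y1|/ltW y1] := leP y 1; first by rewrite (le_trans y1)// lerDl exprn_ge0.
  by rewrite (le_trans (ler_eXnr (isT : (0 < 3)%N) y1))// lerDr.
- apply: le_integrable i13 => //.
    by apply/measurable_EFinP; exact: measurable_funX.
  move=> w _ /=; rewrite lee_fin normrX.
  have := normr_ge0 (X w); move: `|X w| => y y0.
  rewrite ger0_norm; last by rewrite addr_ge0// exprn_ge0.
  have [y1|/ltW y1] := leP y 1.
    by rewrite (le_trans (exprn_ile1 2 y0 y1))// lerDl exprn_ge0.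
  by rewrite (le_trans (ler_weXn2l y1 (isT : (2 <= 3)%N)))// lerDr.
Qed.

Lemma affine_expectation_expansion (mu : probability (measurableTypeR R) R)
    (p phi phit : R -> R) (delta M : R) :
  measurable_fun setT phi -> 0 < delta ->
  (forall x, 1 - delta <= x <= 1 + delta -> phit x = phi x) ->
  (forall x, derivable phit x 1) ->
  (forall x, derivable (derive1 phit) x 1) ->
  (forall x, derivable (derive1n 2 phit) x 1) ->
  (forall x, `|derive1n 3 phit x| <= M) ->
  lambda.-integrable setT (EFin \o (phi \- phit)) ->
  (\int[mu]_x x%:E = 0)%E -> (\int[mu]_x (x ^+ 2)%:E = 1)%E ->
  mu.-integrable setT (EFin \o (fun x => `|x| ^+ 3)) ->
  measurable_fun setT p -> (forall x, 0 <= p x) ->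
  (forall B : set R, measurable B -> mu B = (\int[lambda]_(x in B) (p x)%:E)%E) ->
  (fun x => x ^+ 3 * p x) @ +oo --> 0 ->
  (fun x => x ^+ 3 * p x) @ -oo --> 0 ->
  forall e, 0 < e -> exists2 eta, 0 < eta & forall s t, `|s| < eta -> `|t| < eta ->
    t != 0 ->
    `|\int[mu]_x phi (1 + s + t * x) - (phi (1 + s) + derive1n 2 phit 1 / 2 * t ^+ 2)|
      <= e * t ^+ 2.
Proof.
move=> mphi d0 phiE df ddf d3f Mf ipsi mu1 mu2 i3 mp p0 muE py pNy e e0.
have [i1 i2] := integrable_third_moment _ _ mu id (@measurable_id _ _ setT) i3.
have M0 : 0 <= M by apply: le_trans (Mf 0).
have cphit : continuous phit.
  by move=> x; apply/differentiable_continuous/derivable1_diffP.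
have mphit : measurable_fun setT phit by exact: continuous_measurable_fun.
pose psi := phi \- phit.
have psi0 y : `|y - 1| <= delta -> psi y = 0.
  rewrite ler_norml => /andP[y1 y2]; rewrite /psi /= phiE ?subrr//.
  by apply/andP; split; lra.
have e2 : 0 < e / 2 by rewrite divr_gt0.
have [eta1 eta10 small] := affine_tail_integral_small mu p psi delta mp p0 muE
  py pNy d0 psi0 ipsi (e / 2) e2.
pose m3 := \int[mu]_x (`|x| ^+ 3).
have m30 : 0 <= m3 by apply: Rintegral_ge0 => x _; exact: exprn_ge0.
(* With [|s|] and [|t|] below [e / 2 / q], the terms [M * |s|] and [M * m3 * |t|] add up to at most
   [e / 2]; the other half of [e] pays for the tail. The final 1 keeps [q] positive when [M = 0]. *)
pose q := M * (1 + m3) + 1.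
have q0 : 0 < q by rewrite ltr_wpDl// mulr_ge0// addr_ge0.
exists (Num.min (Num.min eta1 delta) (e / 2 / q)).
  by rewrite !lt_min eta10 d0 divr_gt0.
move=> s t; rewrite !lt_min => /andP[/andP[s1 s2] s3] /andP[/andP[t1 _] t3] t0.
pose c := 1 + s.
rewrite -/c.
have phic : phi c = phit c.
  rewrite phiE// /c; move: s2; rewrite ltr_norml => /andP[? ?].
  by apply/andP; split; lra.
have maff := @measurable_affine R c t.
pose a1 := derive1 phit c * t; pose a2 := derive1n 2 phit c / 2 * t ^+ 2.
pose P0 := fun x : R => phit c + (a1 * x + a2 * x ^+ 2).
have ia1 : mu.-integrable setT (EFin \o (fun x => a1 * x)).
  exact: (integrableZl measurableT a1 i1).
have ia2 : mu.-integrable setT (EFin \o (fun x => a2 * x ^+ 2)).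
  exact: (integrableZl measurableT a2 i2).
have ia12 : mu.-integrable setT (EFin \o (fun x => a1 * x + a2 * x ^+ 2)).
  exact: (integrableD measurableT ia1 ia2).
have ic : mu.-integrable setT (EFin \o (fun=> phit c)).
  exact: finite_measure_integrable_cst.
have iP0 : mu.-integrable setT (EFin \o P0).
  exact: (integrableD measurableT ic ia12).
(* Mean zero removes [a1], unit variance keeps [a2], and total mass 1 keeps the constant. *)
have P0E : \int[mu]_x P0 x = phi c + a2.
  rewrite RintegralD// RintegralD// RintegralZl// RintegralZl//.
  rewrite Rintegral_cst// /Rintegral mu1 mu2.
  rewrite [X in fine X](_ : _ = 1%E); last exact: probability_setT.
  by rewrite phic /= mulr1 mulr0 mulr1 add0r.
pose D := fun x => phi (c + t * x) - P0 x.
pose rem := fun x : R => M * `|t| ^+ 3 * `|x| ^+ 3.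
pose tail := fun x : R => `|psi (c + t * x)|.
have mD : measurable_fun setT D.
  apply: measurable_funB; first exact: (measurableT_comp mphi).
  by apply/measurable_EFinP; case/integrableP : iP0.
have Dle x : `|D x| <= rem x + tail x.
  have -> : D x = (phit (c + t * x) - (phit c + derive1 phit c * (t * x)
       + derive1n 2 phit c / 2 * (t * x) ^+ 2)) + psi (c + t * x).
    rewrite /D /P0 /psi /a1 /a2 /=.
    move: (phi _) (phit (c + _)) (phit c) (derive1 phit c) (derive1 (derive1 phit) c).
    by move=> *; ring.
  apply: (le_trans (ler_normD _ _)); rewrite lerD2r.
  apply: (le_trans (@taylor2_norm_le R phit c (t * x) M df ddf d3f Mf)).
  by rewrite /rem normrM exprMn mulrA.
have irem : mu.-integrable setT (EFin \o rem).
  exact: (integrableZl measurableT _ i3).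
have tle : (\int[mu]_x (tail x)%:E <= (e / 2 * t ^+ 2)%:E)%E by exact: small.
have mtail : measurable_fun setT tail.
  apply: measurableT_comp => //; apply: (measurableT_comp _ maff).
  exact: measurable_funB.
(* The smallness estimate [tle] itself provides the finite integral. *)
have itail : mu.-integrable setT (EFin \o tail).
  apply/integrableP; split; first exact/measurable_EFinP.
  apply: le_lt_trans (ltry (e / 2 * t ^+ 2)).
  by under eq_integral do rewrite /= normr_id.
have irt : mu.-integrable setT (EFin \o (fun x => rem x + tail x)).
  exact: (integrableD measurableT irem itail).
(* Domination makes [D] integrable, so the integral of [phi (c + t * x)], which is [P0 x + D x], can
   be split. *)
have iD : mu.-integrable setT (EFin \o D).
  apply: le_integrable irt => //; first exact/measurable_EFinP.
  by move=> x _ /=; rewrite lee_fin (le_trans (Dle x))// ler_norm.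
have -> : \int[mu]_x phi (c + t * x) = phi c + a2 + \int[mu]_x D x.
  rewrite -P0E -RintegralD//; apply: eq_Rintegral => x _.
  by rewrite /D subrKC.
have Dint : `|\int[mu]_x D x| <= M * `|t| ^+ 3 * m3 + e / 2 * t ^+ 2.
  apply: (le_trans (le_normr_Rintegral _ _)) => //.
  apply: (@le_trans _ _ (\int[mu]_x (rem x + tail x))).
    by apply: le_Rintegral => //; exact: (integrable_abse iD).
  rewrite RintegralD// /rem RintegralZl// lerD2l.
  by rewrite -lee_fin /Rintegral fineK//; exact: (integrable_fin_num measurableT itail).
(* Moving the second derivative from [c] to 1 costs [M * |s|], since it is [M]-Lipschitz. *)
have d2le : `|derive1n 2 phit c - derive1n 2 phit 1| <= M * `|s|.
  exact: (@norm_increment_le R (derive1n 2 phit) 1 s M d3f (fun y _ => Mf y)).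
rewrite (_ : _ - _ = (derive1n 2 phit c - derive1n 2 phit 1) / 2 * t ^+ 2
    + \int[mu]_x D x); last first.
  rewrite /a2; move: (Rintegral _ _ _) (phi c) (derive1n 2 phit c) (derive1n 2 phit 1).
  by move=> *; field.
apply: (le_trans (ler_normD _ _)).
rewrite normrM normrM normrX normfV (ger0_norm (_ : 0 <= 2))//.
move: Dint d2le; rewrite -(real_normK (num_real t)).
move: (`|_ - _|) (`|Rintegral _ _ _|) => u v uv1 uv2.
have t2 : 0 < `|t| ^+ 2 by rewrite exprn_gt0// normr_gt0.
apply: (@le_trans _ _ ((M * `|s| + M * m3 * `|t| + e / 2) * `|t| ^+ 2)).
  rewrite !mulrDl -addrA lerD//; last by apply: (le_trans uv1); rewrite lerD2r; lra.
  rewrite ler_wpM2r// ?exprn_ge0//.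
  have Ms0 : 0 <= M * `|s| by rewrite mulr_ge0.
  by rewrite ler_pdivrMr// (le_trans uv2)// ler_peMr// ler1n.
rewrite ler_wpM2r// ?exprn_ge0//.
rewrite [leRHS](splitr e) lerD2r.
apply: (@le_trans _ _ (M * (e / 2 / q) + M * m3 * (e / 2 / q))).
  by apply: lerD; rewrite ler_wpM2l// ?mulr_ge0// ltW.
rewrite -mulrDl -{1}[M]mulr1 -mulrDr -[leRHS](divfK (lt0r_neq0 q0)) mulrC.
by rewrite ler_wpM2l ?divr_ge0// ?lerDl// ltW.
Qed.

End quadratic_expansion.

(** * Conditional expectation of a function of an independent variable *)

Section conditional_expectation.
Context {d : measure_display} {Omega : measurableType d} {R : realType}.

(** [g_sigma_algebraType F] is [Omega] with the sigma-algebra generated by [F], which turns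
    measurability relative to [F] into ordinary measurability. *)
Lemma measurable_wrt_fun (F : set (set Omega)) (f : Omega -> R) :
  measurable_wrt F f ->
  measurable_fun setT (f : g_sigma_algebraType F -> R).
Proof. by move=> mf _ B mB; rewrite setTI; apply: sub_sigma_algebra; exact: mf. Qed.

(* On the product of (Omega, F) and the line, independence says that the joint law
   of (w, xi w) is the product measure, so that Fubini applies. *)
Lemma cond_exp_indep (P : probability Omega R) (F : set (set Omega))
    (xi : {mfun Omega >-> measurableTypeR R})
    (Phi : g_sigma_algebraType F * measurableTypeR R -> R) (Y : Omega -> R) :
  is_sub_sigma_algebra F -> indep_sigma P F xi -> measurable_fun setT Phi ->
  is_cond_exp P F (fun w => Phi (w, xi w)) Y ->
  {ae P, forall w, Y w = \int[distribution P xi]_x Phi (w, x)}.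
Proof.
move=> [sF FsubM] indep mPhi [iX mY iY condY].
pose T := g_sigma_algebraType F.
(* [F] is already a sigma-algebra, so generating from it adds no set. *)
have measF (A : set Omega) : @measurable _ T A -> F A.
  by rewrite /measurable /= sigma_algebra_id.
have mid : measurable_fun setT (id : Omega -> T).
  by move=> _ A mA; rewrite setTI; apply: FsubM; exact: measF.
have mjoint : measurable_fun setT (fun w : Omega => (w : T, xi w)).
  by apply/measurable_fun_pairP; split => //; exact: measurable_funPT.
pose idm : {mfun Omega >-> T} := HB.pack (id : Omega -> T)
  (isMeasurableFun.Build _ _ _ _ _ mid).
pose joint : {mfun Omega >-> (T * measurableTypeR R)%type} :=
  HB.pack (fun w : Omega => (w : T, xi w)) (isMeasurableFun.Build _ _ _ _ _ mjoint).
pose P' := distribution P idm.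
pose mu := distribution P xi.
pose J := distribution P joint.
(* Independence is the product formula on rectangles, which determines the product measure. *)
have JE A : measurable A -> (P' \x mu)%E A = J A.
  apply: product_measure_unique => B C mB mC.
  rewrite /J /P' /mu /distribution /pushforward /=.
  by rewrite -indep//; exact: measF.
have mEPhi : measurable_fun setT (EFin \o Phi) by exact/measurable_EFinP.
have iJ : J.-integrable setT (EFin \o Phi).
  by apply: integrable_pushforward => //; rewrite preimage_setT.
have iprod : (P' \x mu)%E.-integrable setT (EFin \o Phi).
  apply/integrableP; split => //; rewrite (eq_measure_integral J).
    by case/integrableP : iJ.
  by move=> A mA _; exact: JE.
have mY' : measurable_fun setT (EFin \o (Y : T -> R)).
  by apply/measurable_EFinP; exact: (measurable_wrt_fun F Y mY).
have iY' : P'.-integrable setT (EFin \o (Y : T -> R)).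
  by apply: integrable_pushforward => //; rewrite preimage_setT.
(* Two [F]-measurable integrable functions with equal integrals over every set of [F] agree almost
   everywhere. *)
have key : ae_eq P' setT (EFin \o (Y : T -> R)) (fubini_F mu (EFin \o Phi)).
  apply: integral_ae_eq => //; first exact: (measurable_fubini_F iprod).
  move=> E _ mE.
  have FE := measF _ mE.
  have mET : measurable (E `*` setT : set (T * measurableTypeR R)).
    exact: measurableX.
  have iE : (P' \x mu)%E.-integrable setT ((EFin \o Phi) \_ (E `*` setT)).
    by apply/integrable_restrict => //; rewrite setTI; exact: integrableS iprod.
  transitivity (\int[P]_(w in E) (Y w)%:E)%E.
    rewrite (@integral_pushforward _ _ _ _ _ _ mid P E (EFin \o Y))//.
    apply: integrableS iY => //; exact: FsubM.
  rewrite (condY _ FE).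
  (* The event [E] becomes a cylinder in the product, whose indicator does not depend on the
     variable of the inner integral. *)
  transitivity (\int[J]_(z in E `*` setT) (Phi z)%:E)%E.
    have jE : joint @^-1` (E `*` setT) = E.
      by apply/seteqP; split => w //= [].
    rewrite (@integral_pushforward _ _ _ _ _ _ mjoint P (E `*` setT)
      (EFin \o Phi))// jE//.
    apply: integrableS iX => //; exact: FsubM.
  transitivity (\int[(P' \x mu)%E]_(z in E `*` setT) (Phi z)%:E)%E.
    by apply: eq_measure_integral => A mA _; exact/esym/JE.
  rewrite [LHS]integral_mkcond [RHS]integral_mkcond.
  transitivity (\int[P']_w fubini_F mu ((EFin \o Phi) \_ (E `*` setT)) w)%E.
    exact: (esym (integral12_prod_meas1 iE)).
  apply: eq_integral => w _; rewrite /fubini_F patchE.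
  case: ifPn => wE.
    apply: eq_integral => x _; rewrite patchE ifT// inE; split => //=.
    by rewrite inE in wE.
  under eq_integral => x _.
    rewrite patchE ifF; last first.
      by apply/negbTE; apply: contra wE; rewrite !inE => -[].
    over.
  by rewrite integral0.
(* The exceptional set lies in [F], hence is measurable in [Omega] and null for [P]. *)
case: key => B [mB PB0 sub].
exists B; split; [exact/FsubM/measF|exact: PB0|].
move=> w /= nYw; apply: sub => /= /(_ I) Yw; apply: nYw.
by rewrite /Rintegral -[X in fine X]Yw.
Qed.

Lemma measurable_wrt_affine_comp (F : set (set Omega)) (phi : R -> R)
    (f g : Omega -> R) : measurable_fun setT phi ->
  measurable_wrt F f -> measurable_wrt F g ->
  measurable_fun setT (fun z : g_sigma_algebraType F * measurableTypeR R =>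
    phi (1 + f z.1 + g z.1 * z.2)).
Proof.
move=> mphi mf mg; apply: (measurableT_comp mphi); apply: measurable_funD.
  apply: measurable_funD; first exact: measurable_cst.
  exact: (measurableT_comp (measurable_wrt_fun F f mf)).
apply: measurable_funM; last exact: measurable_snd.
exact: (measurableT_comp (measurable_wrt_fun F g mg)).
Qed.

Lemma measurable_wrtMr (F : set (set Omega)) (f : Omega -> R) (r : R) :
  measurable_wrt F f -> measurable_wrt F (fun w => f w * r).
Proof.
move=> mf B mB.
have mMr : measurable_fun setT (fun x : R => x * r) by exact: measurable_funM.
by have := mf _ (mMr measurableT B mB); rewrite setTI.
Qed.

End conditional_expectation.

(** * Error terms and their uniformity *)

Section error_terms.
Context {R : realType}.

(** With coefficients below [K], it suffices that [h] and [sqrt h] stay below [eta / K]; the second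
    condition is where the square comes from. *)
Lemma scaled_error_small_time (K eta : R) : 0 < K -> 0 < eta ->
  exists2 h0, 0 < h0 & forall h a b, 0 < h < h0 -> `|a| < K -> `|b| < K ->
    `|a * h| < eta /\ `|b * Num.sqrt h| < eta.
Proof.
move=> K0 eta0; have q0 : 0 < eta / K by rewrite divr_gt0.
exists (Num.min (eta / K) ((eta / K) ^+ 2)).
  by rewrite lt_min q0 exprn_gt0.
move=> h a b /andP[h0]; rewrite lt_min => /andP[h1 h2] aK bK.
have sh : Num.sqrt h < eta / K.
  by rewrite -[ltRHS]ger0_norm ?(ltW q0)// -sqrtr_sqr ltr_sqrt// exprn_gt0.
have prod (u v : R) : `|u| < K -> 0 < v < eta / K -> `|u * v| < eta.
  move=> uK /andP[v0 v1]; rewrite normrM (gtr0_norm v0).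
  rewrite -[ltRHS](divfK (lt0r_neq0 K0)) mulrC.
  by rewrite ltr_pM// ltW.
by split; apply: prod; rewrite ?h0 ?sqrtr_gt0 ?h0.
Qed.

(** Here [h] and [sqrt h] are only bounded, by [H] and [sqrt H], and the smallness comes from the
    coefficients. *)
Lemma scaled_error_small_coef (H eta : R) : 0 < H -> 0 < eta ->
  exists2 e0, 0 < e0 & forall h a b, 0 < h < H -> `|a| < e0 -> `|b| < e0 ->
    `|a * h| < eta /\ `|b * Num.sqrt h| < eta.
Proof.
move=> H0 eta0; have sH0 : 0 < Num.sqrt H by rewrite sqrtr_gt0.
exists (Num.min (eta / H) (eta / Num.sqrt H)).
  by rewrite lt_min !divr_gt0.
move=> h a b /andP[h0 hH]; rewrite !lt_min => /andP[a1 _] /andP[_ b2].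
have prod (u v w : R) : 0 < w -> `|u| < eta / w -> 0 < v < w -> `|u * v| < eta.
  move=> w0 uK /andP[v0 v1]; rewrite normrM (gtr0_norm v0).
  rewrite -[ltRHS](divfK (lt0r_neq0 w0)).
  by rewrite ltr_pM// ltW.
split; first by apply: (prod _ _ H); rewrite ?h0.
by apply: (prod _ _ (Num.sqrt H)); rewrite ?sqrtr_gt0 ?h0 ?ltr_sqrt.
Qed.

(** Derivatives are local. The conclusion has the shape of the hypothesis, so the lemma iterates to
    second derivatives. *)
Lemma derive1_eq_itvoo (f g : R -> R) (a r : R) :
  (forall x, a - r < x < a + r -> f x = g x) ->
  forall x, a - r < x < a + r -> derive1 f x = derive1 g x.
Proof.
move=> fg x xr; rewrite !derive1E; apply: near_eq_derive.
have : x \in `]a - r, a + r[ by rewrite in_itv.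
by move=> /near_in_itvoo; apply: filterS => y; rewrite in_itv/=; exact: fg.
Qed.

(** Taylor's formula makes the numerator quadratic in [s], so the quotient is of order [|s|]. *)
Lemma difference_quotient_error_small (f : R -> R) (M : R) :
  (forall x, derivable f x 1) ->
  (forall x, derivable (derive1 f) x 1) ->
  (forall x, derivable (derive1n 2 f) x 1) ->
  (forall x, `|derive1n 3 f x| <= M) ->
  forall c e, 0 < e -> exists2 eta, 0 < eta & forall s, `|s| < eta ->
    `|(f (c + s) - f c - derive1 f c * s) / s| < e.
Proof.
move=> df ddf d3f Mf c e e0.
have M0 : 0 <= M by apply: le_trans (Mf 0).
pose q := `|derive1n 2 f c / 2| + M + 1.
have q0 : 0 < q by rewrite ltr_wpDl// addr_ge0.
(* [|s| < 1] absorbs the cubic remainder into [|s| ^+ 2], so the numerator is at most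
   [q * |s| ^+ 2]. *)
exists (Num.min 1 (e / q)); first by rewrite lt_min ltr01 divr_gt0.
move=> s; rewrite lt_min => /andP[s1 s2].
have [->|s0] := eqVneq s 0; first by rewrite invr0 mulr0 normr0.
have ns0 : 0 < `|s| by rewrite normr_gt0.
rewrite normrM normfV ltr_pdivrMr//.
rewrite (_ : _ - _ = (f (c + s) - (f c + derive1 f c * s + derive1n 2 f c / 2 * s ^+ 2))
  + derive1n 2 f c / 2 * s ^+ 2); last first.
  by move: (f _) (f c) (derive1 f c) (derive1n 2 f c / 2) => *; ring.
apply: (le_lt_trans (ler_normD _ _)).
apply: (@le_lt_trans _ _ (q * `|s| ^+ 2)); last first.
  by rewrite expr2 mulrA ltr_pM2r// mulrC -ltr_pdivlMr.
rewrite normrM normrX.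
apply: (@le_trans _ _ (M * `|s| ^+ 2 + `|derive1n 2 f c / 2| * `|s| ^+ 2)).
  rewrite lerD2r (le_trans (@taylor2_norm_le R f c s M df ddf d3f Mf))//.
  by rewrite ler_wpM2l// ler_wiXn2l// ltW.
by rewrite -mulrDl ler_wpM2r ?exprn_ge0// /q addrC lerDl.
Qed.

(* Division by zero yields zero, so eps1 and eps2 need no separate treatment at
   s = 0 and t = 0. *)
Lemma expansion_errors_small (phi phit : R -> R) (delta M : R) (G : R -> R -> R) :
  0 < delta ->
  (forall x, 1 - delta <= x <= 1 + delta -> phit x = phi x) ->
  (forall x, derivable phit x 1) ->
  (forall x, derivable (derive1 phit) x 1) ->
  (forall x, derivable (derive1n 2 phit) x 1) ->
  (forall x, `|derive1n 3 phit x| <= M) ->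
  (forall e, 0 < e -> exists2 eta, 0 < eta & forall s t, `|s| < eta -> `|t| < eta ->
    t != 0 ->
    `|G s t - (phi (1 + s) + derive1n 2 phit 1 / 2 * t ^+ 2)| <= e * t ^+ 2) ->
  forall e, 0 < e -> exists2 eta, 0 < eta & forall s t, `|s| < eta -> `|t| < eta ->
    `|(phi (1 + s) - phi 1 - derive1 phi 1 * s) / s| < e /\
    `|(G s t - (phi (1 + s) + derive1n 2 phi 1 / 2 * t ^+ 2)) / t ^+ 2| < e.
Proof.
move=> d0 phiE df ddf d3f Mf expansion e e0.
have phiE' x : 1 - delta < x < 1 + delta -> phit x = phi x.
  by move=> /andP[x1 x2]; apply: phiE; rewrite !ltW.
(* Agreement near 1 carries the first, then the second derivative from [phit] over to [phi]. *)
have d1E := derive1_eq_itvoo _ _ _ _ phiE'.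
have d2E := derive1_eq_itvoo _ _ _ _ d1E.
have in1 : 1 - delta < 1 < 1 + delta by rewrite gtrBl ltrDl d0.
rewrite -(d1E _ in1) -[derive1n 2 phi 1](d2E _ in1).
have [eta1 eta10 H1] := difference_quotient_error_small phit M df ddf d3f Mf 1 e e0.
(* Half of [e] turns the weak inequality of [expansion] into a strict one. *)
have [eta2 eta20 H2] := expansion (e / 2) (divr_gt0 e0 (ltr0Sn _ _)).
exists (Num.min (Num.min eta1 delta) eta2); first by rewrite !lt_min eta10 d0.
move=> s t; rewrite !lt_min => /andP[/andP[s1 s2] s3] /andP[_ t3]; split.
  rewrite -(phiE' _ in1) -(phiE' (1 + s)); first exact: H1.
  by move: s2; rewrite ltr_norml !ltrD2l.
have [->|t0] := eqVneq t 0; first by rewrite expr0n/= invr0 mulr0 normr0.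
have t20 : 0 < t ^+ 2 by rewrite exprn_even_gt0.
rewrite normrM normfV (gtr0_norm t20) ltr_pdivrMr//.
apply: (le_lt_trans (H2 s t s3 t3 t0)).
by rewrite ltr_pM2r// ltr_pdivrMr// mulr_natr mulr2n ltrDl.
Qed.

(** Both regimes matter only in that they make [s = a * h] and [t = b * sqrt h] small. *)
Lemma scaled_errors_small (e1 : R -> R) (e2 : R -> R -> R) :
  (forall e, 0 < e -> exists2 eta, 0 < eta & forall s t, `|s| < eta -> `|t| < eta ->
    `|e1 s| < e /\ `|e2 s t| < e) ->
  (forall K, 0 < K -> forall e, 0 < e -> exists eta, 0 < eta /\
     forall h a b, 0 < h < eta -> `|a| < K -> `|b| < K ->
       `|e1 (a * h)| < e /\ `|e2 (a * h) (b * Num.sqrt h)| < e) /\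
  (forall H, 0 < H -> forall e, 0 < e -> exists eta, 0 < eta /\
     forall h a b, 0 < h < H -> `|a| < eta -> `|b| < eta ->
       `|e1 (a * h)| < e /\ `|e2 (a * h) (b * Num.sqrt h)| < e).
Proof.
move=> small; split.
- move=> K K0 e e0; have [eta eta0 He] := small e e0.
  have [h0 h00 Hh] := scaled_error_small_time K eta K0 eta0.
  exists h0; split => // h a b hh aK bK.
  by have [? ?] := Hh h a b hh aK bK; exact: He.
- move=> H H0 e e0; have [eta eta0 He] := small e e0.
  have [h0 h00 Hh] := scaled_error_small_coef H eta H0 eta0.
  exists h0; split => // h a b hh aK bK.
  by have [? ?] := Hh h a b hh aK bK; exact: He.
Qed.

(** An exact identity: the error terms are the quotients that restore equality. When a divisor
    vanishes, the two implications make its numerator vanish too, so the value 0 of the quotient is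
    harmless. *)
Lemma expansion_of_errors (phi1 phis k1 k2 G a b h : R) : 0 <= h ->
  (b * Num.sqrt h = 0 -> G = phis) -> (a * h = 0 -> phis = phi1) ->
  G = phi1 + k1 * a * h + k2 * b ^+ 2 * h
    + h * a * ((phis - phi1 - k1 * (a * h)) / (a * h))
    + h * b ^+ 2 *
      ((G - (phis + k2 * (b * Num.sqrt h) ^+ 2)) / (b * Num.sqrt h) ^+ 2).
Proof.
move=> h0 Gt0 phis0.
have t2E : (b * Num.sqrt h) ^+ 2 = b ^+ 2 * h by rewrite exprMn sqr_sqrtr.
have -> : h * a * ((phis - phi1 - k1 * (a * h)) / (a * h)) =
    phis - phi1 - k1 * (a * h).
  rewrite (mulrC h a); have [s0|s0] := eqVneq (a * h) 0.
    by rewrite s0 (phis0 s0) mul0r mulr0 subr0 subrr.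
  by rewrite [LHS]mulrC divfK.
have -> : h * b ^+ 2 *
    ((G - (phis + k2 * (b * Num.sqrt h) ^+ 2)) / (b * Num.sqrt h) ^+ 2) =
    G - (phis + k2 * (b * Num.sqrt h) ^+ 2).
  rewrite (mulrC h) -t2E; have [t0|t0] := eqVneq (b * Num.sqrt h) 0.
    by rewrite (Gt0 t0) t0 expr0n/= mul0r mulr0 addr0 subrr.
  by rewrite mulrC divfK// expf_neq0.
by rewrite t2E; ring.
Qed.

End error_terms.

(** * Transfer to the law of [xi] and conclusion *)

Theorem theorem1 (R : realType) (phi phit : R -> R) (delta M : R)
  (d : measure_display) (Omega : measurableType d) (P : probability Omega R)
  (F : set (set Omega)) (xi : Omega -> R) (p : R -> R) :
  measurable_fun setT phi ->
  0 < delta ->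
  (forall x, 1 - delta <= x <= 1 + delta -> phit x = phi x) ->
  (forall x, derivable phit x 1) ->
  (forall x, derivable (derive1 phit) x 1) ->
  (forall x, derivable (derive1n 2 phit) x 1) ->
  continuous (derive1n 3 phit) ->
  (forall x, `|derive1n 3 phit x| <= M) ->
  lebesgue_measure.-integrable setT (EFin \o (phi \- phit)) ->
  is_sub_sigma_algebra F ->
  measurable_fun setT xi ->
  indep_sigma P F xi ->
  (\int[P]_w (xi w)%:E = 0)%E ->
  (\int[P]_w (xi w ^+ 2)%:E = 1)%E ->
  P.-integrable setT (EFin \o (fun w => `|xi w| ^+ 3)) ->
  is_density P xi p ->
  (fun x => x ^+ 3 * p x) @ +oo --> 0 ->
  (fun x => x ^+ 3 * p x) @ -oo --> 0 ->
  exists eps1 eps2 : R -> R -> R -> R,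
    (* (i) for every K > 0, eps_i -> 0 as h -> 0+, uniformly in |a|,|b| < K *)
    (forall K, 0 < K -> forall e, 0 < e -> exists eta, 0 < eta /\
       forall h a b, 0 < h < eta -> `|a| < K -> `|b| < K ->
         `|eps1 h a b| < e /\ `|eps2 h a b| < e) /\
    (* (ii) for every H > 0, eps_i -> 0 as (a,b) -> 0, uniformly in 0 < h < H *)
    (forall H, 0 < H -> forall e, 0 < e -> exists eta, 0 < eta /\
       forall h a b, 0 < h < H -> `|a| < eta -> `|b| < eta ->
         `|eps1 h a b| < e /\ `|eps2 h a b| < e) /\
    (* the expansion of the conditional expectation *)
    (forall (f g : Omega -> R) (h : R),
       measurable_wrt F f -> measurable_wrt F g ->
       (exists C, forall w, `|f w| <= C) -> (exists C, forall w, `|g w| <= C) ->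
       0 < h ->
       forall Y : Omega -> R,
         is_cond_exp P F
           (fun w => phi (1 + f w * h + g w * Num.sqrt h * xi w)) Y ->
         {ae P, forall w,
            Y w = phi 1 + derive1 phi 1 * f w * h
                  + derive1n 2 phi 1 / 2 * g w ^+ 2 * h
                  + h * f w * eps1 h (f w) (g w)
                  + h * g w ^+ 2 * eps2 h (f w) (g w)}).
Proof.
move=> mphi d0 phiE df ddf d3f _ Mf ipsi sF mxi indep xi1 xi2 xi3 [mp p0 pE] py pNy.
have mxi' : measurable_fun setT (xi : Omega -> measurableTypeR R) by exact: mxi.
pose xim : {mfun Omega >-> measurableTypeR R} :=
  HB.pack (xi : Omega -> measurableTypeR R) (isMeasurableFun.Build _ _ _ _ _ mxi').
pose mu := distribution P xim.
have [ixi ixi2] := integrable_third_moment _ _ P xi mxi xi3.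
have mid : measurable_fun setT (fun x : measurableTypeR R => x%:E).
  exact/measurable_EFinP/measurable_id.
have msq : measurable_fun setT (fun x : measurableTypeR R => (x ^+ 2)%:E).
  exact/measurable_EFinP/measurable_funX.
have mcube : measurable_fun setT (fun x : measurableTypeR R => (`|x| ^+ 3)%:E).
  exact/measurable_EFinP/measurable_funX.
have mu1 : (\int[mu]_x x%:E = 0)%E.
  by rewrite -[RHS]xi1; exact: integral_distribution.
have mu2 : (\int[mu]_x (x ^+ 2)%:E = 1)%E.
  by rewrite -[RHS]xi2; exact: (@integral_distribution _ _ _ _ _ P xim _ msq).
have mu3 : mu.-integrable setT (EFin \o (fun x => `|x| ^+ 3)).
  by apply: integrable_pushforward => //; rewrite preimage_setT.
have expansion := affine_expectation_expansion mu p phi phit delta M mphi d0 phiE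
  df ddf d3f Mf ipsi mu1 mu2 mu3 mp p0 pE py pNy.
pose G s t := \int[mu]_x phi (1 + s + t * x).
have := expansion_errors_small phi phit delta M G d0 phiE df ddf d3f Mf expansion.
pose e1 s := (phi (1 + s) - phi 1 - derive1 phi 1 * s) / s.
pose e2 s t := (G s t - (phi (1 + s) + derive1n 2 phi 1 / 2 * t ^+ 2)) / t ^+ 2.
move=> /(scaled_errors_small e1 e2)[small_time small_coef].
(* The witnesses see [(h, a, b)] only through [s] and [t], so one pair serves all [f] and [g]. *)
exists (fun h a b => e1 (a * h)), (fun h a b => e2 (a * h) (b * Num.sqrt h)).
split; first exact: small_time.
split; first exact: small_coef.
move=> f g h mf mg _ _ h0 Y condY.
(* The factors [h] and [sqrt h] are absorbed into the coefficients: [s] is [f w * h] and [t] is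
   [g w * sqrt h]. *)
have mPhi := measurable_wrt_affine_comp F phi _ _ mphi
  (measurable_wrtMr F f h mf) (measurable_wrtMr F g (Num.sqrt h) mg).
have := cond_exp_indep P F xim _ Y sF indep mPhi condY.
apply: filterS => w ->.
apply: expansion_of_errors; first exact: ltW.
  (* For [t = 0] the integrand is constant in [x], and [mu] has mass 1. *)
  move=> /= t0.
  rewrite (_ : (fun x : measurableTypeR R => _) = fun=> phi (1 + f w * h)).
    rewrite Rintegral_cst; last exact: measurableT.
    by rewrite [X in fine X](_ : _ = 1%E) ?mulr1; last exact: probability_setT.
  by apply/funext => x; rewrite t0 mul0r addr0.
by move=> s0; rewrite s0 addr0.
Qed.
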